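(* Let $(b_n)_{n\ge0}$ be a bounded sequence of positive numbers. Then $$\liminf_{n\to\infty}U_n^{1/n}\ge4 .$$ If $\lim_{n\to\infty} b_n=b\ge0$, then the $\liminf$ is a limit (in $[4,\infty]$).
   Context: Given positive numbers $(b_n)_{n\ge0}$, let $P_{-1}=0$, $P_0=1$ and $xP_n(x)=b_nP_{n+1}(x)+b_{n-1}P_{n-1}(x)$, $n\ge0$ (the value of $b_{-1}$ is irrelevant). There is a probability measure $\mu$ on $\mathbb{R}$ for which $(P_n)$ are the orthonormal polynomials; its moments $s_n=\int x^n\,d\mu$ depend only on $(b_n)$; equivalently $s_n=\langle J^n\delta_0,\delta_0\rangle$, where $J$ is the Jacobi matrix $J\delta_n=b_n\delta_{n+1}+b_{n-1}\delta_{n-1}$ (with $b_{-1}\delta_{-1}:=0$) and $(\delta_n)_{n\ge0}$ is the standard orthonormal basis of $\ell^2(\mathbb{N}_0)$. Define $$U_n=\frac{s_{2n}}{b_0^2b_1^2\cdots b_{n-1}^2}\ \ (n\ge1),\qquad U_0=1.$$ *)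

(* Defs.v *)
From mathcomp Require Import all_boot all_order all_algebra.
From mathcomp Require Import all_classical all_reals all_analysis.

Set Implicit Arguments.
Unset Strict Implicit.
Unset Printing Implicit Defensive.

Import Order.TTheory GRing.Theory Num.Theory.
Import numFieldNormedType.Exports.

Local Open Scope classical_set_scope.
Local Open Scope ring_scope.

Definition delta_seq {R : realType} (n : nat) : R^nat := fun k => (k == n)%:R.

(* [\sum_k u k * v k]; a finite sum as soon as [u] or [v] is finitely supported,
   which is the only case in which it is used below. *)
Definition dotl2 {R : realType} (u v : R^nat) : R :=
  limn (series (fun k => u k * v k)).

(* Coordinates of [J v] for the Jacobi matrix [J delta_n = b_n delta_(n+1) +
   b_(n-1) delta_(n-1)]; see [jacobi_delta0] and [jacobi_deltaS]. *)
Definition jacobi {R : realType} (b : R^nat) (v : R^nat) : R^nat :=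
  fun k => b k * v k.+1 + (if k is j.+1 then b j * v j else 0).

Definition jmoment {R : realType} (b : R^nat) (n : nat) : R :=
  dotl2 (iter n (jacobi b) (delta_seq 0)) (delta_seq 0).

Definition U {R : realType} (b : R^nat) (n : nat) : R :=
  jmoment b n.*2 / \prod_(i < n) b i ^+ 2.

Fixpoint orthopoly {R : realType} (b : R^nat) (n : nat) : {poly R} :=
  match n with
  | 0 => 1
  | n'.+1 => (b n')^-1 *:
      ('X * orthopoly b n' -
       (if n' is n''.+1 then b n'' *: orthopoly b n'' else 0))
  end.

Definition orthonormal_for {R : realType}
    (mu : probability (measurableTypeR R) R) (P : nat -> {poly R}) : Prop :=
  (forall n, mu.-integrable setT (fun x : R => (x ^+ n)%:E)) /\
  (forall m n,
     (\int[mu]_x ((P m).[x] * (P n).[x])%:E)%E = ((m == n)%:R : R)%:E).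

Lemma jacobi_delta0 {R : realType} (b : R^nat) :
  jacobi b (delta_seq 0) = b 0%N \*o delta_seq 1.
Proof.
apply/funext => -[|[|k]]; rewrite /jacobi /delta_seq /=;
  by rewrite ?mulr0 ?mulr1 ?add0r ?addr0.
Qed.

Lemma jacobi_deltaS {R : realType} (b : R^nat) (n : nat) :
  jacobi b (delta_seq n.+1) =
  (b n.+1 \*o delta_seq n.+2) \+ (b n \*o delta_seq n).
Proof.
apply/funext => -[|k]; rewrite /jacobi /delta_seq /= ?eqSS.
  by rewrite mulr0 addr0 add0r; case: eqP => [<-|]; rewrite ?mulr0.
rewrite addrC; congr (_ + _); first by case: eqP => [->|]; rewrite ?mulr0.
by case: eqP => [->|]; rewrite ?mulr0.
Qed.

Lemma dotl2_delta0 {R : realType} (u : R^nat) : dotl2 u (delta_seq 0) = u 0%N.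
Proof.
rewrite /dotl2; apply: cvg_lim => //.
rewrite -(cvg_shiftS (series _)) /=.
rewrite (_ : (fun _ => _) = fun=> u 0%N); first exact: cvg_cst.
apply/funext => n; rewrite /series /= big_nat_recl //= /delta_seq mulr1.
by rewrite big1 ?addr0 // => i _; rewrite mulr0.
Qed.

Lemma orthopoly_rec {R : realType} (b : R^nat) (n : nat) :
  (forall k, 0 < b k) ->
  'X * orthopoly b n = b n *: orthopoly b n.+1 +
    (if n is m.+1 then b m *: orthopoly b m else 0).
Proof.
move=> b0 /=; rewrite scalerA divff ?gt_eqF// scale1r.
by rewrite subrK.
Qed.

Lemma integrable_poly {R : realType} (mu : probability (measurableTypeR R) R) :
  (forall n, mu.-integrable setT (fun x : R => (x ^+ n)%:E)) ->
  forall p : {poly R}, mu.-integrable setT (fun x : R => (p.[x])%:E).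
Proof.
move=> Hi p.
rewrite (_ : (fun _ => _) =
    (fun x : R => \sum_(i < size p) (p`_i)%:E * (x ^+ i)%:E)%E).
  by apply: integrable_sum => // i _; exact: (integrableZl measurableT _ (Hi i)).
by apply/funext => x; rewrite horner_coef -sumEFin; apply: eq_bigr => i _.
Qed.

(* The moments of any probability measure for which the polynomials
   [orthopoly b] are orthonormal are the numbers [jmoment b n]. *)
Lemma moment_jmoment {R : realType} (b : R^nat)
    (mu : probability (measurableTypeR R) R) :
  (forall n, 0 < b n) -> orthonormal_for mu (orthopoly b) ->
  forall n, (\int[mu]_x (x ^+ n)%:E)%E = (jmoment b n)%:E.
Proof.
move=> b0 [Hi Ho] n; have Hp := integrable_poly Hi.
suff /(_ n 0%N) : forall n k, (\int[mu]_x (('X^n * orthopoly b k).[x])%:E)%E =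
    (iter n (jacobi b) (delta_seq 0) k)%:E.
  rewrite /jmoment dotl2_delta0 => <-.
  by apply: eq_integral => x _; rewrite mulr1 hornerXn.
elim=> [|{}n IH] k.
  rewrite -Ho; apply: eq_integral => x _.
  by rewrite /= mul1r hornerC mulr1.
rewrite iterS {1}/jacobi EFinD !EFinM -!IH.
transitivity (\int[mu]_x ((b k)%:E * (('X^n * orthopoly b k.+1).[x])%:E +
   (('X^n * (if k is j.+1 then b j *: orthopoly b j else 0)).[x])%:E))%E.
  apply: eq_integral => x _; rewrite exprSr -mulrA orthopoly_rec//.
  by rewrite mulrDr hornerD -scalerAr hornerZ EFinD EFinM.
rewrite (integralD measurableT); last 2 first.
- exact: (integrableZl measurableT _ (Hp _)).
- exact: Hp.
rewrite (integralZl measurableT (Hp _)); congr (_ + _)%E.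
case: k => [|k]; first by rewrite mulr0; under eq_integral do rewrite horner0; rewrite integral0.
rewrite EFinM -IH -(integralZl measurableT (Hp _)).
by apply: eq_integral => x _; rewrite -scalerAr hornerZ EFinM.
Qed.

(* Main.v *)
Require Import Defs.
From mathcomp Require Import all_boot all_order all_algebra.
From mathcomp Require Import all_classical all_reals all_analysis.
From mathcomp Require Import ring lra.

(* By supermultiplicativity (Fekete), [s_(2n)] grows like [M ^+ n]. For
   [x > sqrt M] the resolvent vector [h = \sum_m x ^- m * J ^+ m delta_0] is
   positive and satisfies [J h <= x h], which by a telescoping AM-GM bound on
   the ratios of [h] forces [b_0^2 ... b_(n-1)^2 <= 4 (x ^+ 2 / 4) ^+ n].
   Letting [x ^+ 2] decrease to [M] gives the bound [4]. When [b] tends to [l],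
   the product grows like [l ^+ n.*2], so [U_n^(1/n)] tends to [M / l ^+ 2]
   (to [+oo] if [l = 0]). *)

Set Implicit Arguments.
Unset Strict Implicit.

Import Order.TTheory GRing.Theory Num.Theory.
Import numFieldNormedType.Exports.

Local Open Scope classical_set_scope.
Local Open Scope ring_scope.

(** * Geometric comparison and the passage to [n]-th roots *)

Lemma geometric_le_near {R : realType} (c s t : R) :
  0 < c -> 0 <= s -> s < t -> \forall n \near \oo, s ^+ n <= c * t ^+ n.
Proof.
move=> c0 s0 st; have t0 : 0 < t by exact: le_lt_trans st.
have q1 : `|s / t| < 1.
  by rewrite ger0_norm ?divr_ge0 ?(ltW t0)// ltr_pdivrMr// mul1r.
have /cvgr_le/(_ c) := @cvg_geometric R 1 _ q1.
move=> /(_ c0); apply: filterS => n; rewrite /geometric /= mul1r expr_div_n.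
by rewrite ler_pdivrMr ?exprn_gt0.
Qed.

Lemma exprn_powRV {R : realType} (t : R) n :
  (0 < n)%N -> 0 <= t -> (t ^+ n) `^ n%:R^-1 = t.
Proof.
by move=> n0 t0; rewrite -powR_mulrn // -powRrM divff ?powRr1 // pnatr_eq0 -lt0n.
Qed.

Lemma limn_einf_root_ge {R : realType} (u : R^nat) (t : R) :
  0 <= t -> (\forall n \near \oo, t ^+ n <= u n) ->
  (t%:E <= limn_einf (fun n => (u n `^ n%:R^-1)%:E))%E.
Proof.
move=> t0 [N _ tu]; rewrite limn_einf_lim.
apply: lime_ge; first exact: is_cvg_einfs.
exists N.+1 => // n /= Nn; apply: le_ereal_inf_tmp => _ [m /= nm <-].
have m0 : (0 < m)%N by rewrite (leq_trans _ nm) // (leq_trans _ Nn).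
have tm : t ^+ m <= u m by apply: tu; rewrite /= (leq_trans _ nm) // ltnW.
rewrite lee_fin -[leLHS](exprn_powRV m0) //; apply: ge0_ler_powR => //.
  by rewrite nnegrE exprn_ge0.
by rewrite nnegrE (le_trans _ tm) // exprn_ge0.
Qed.

Lemma limn_esup_root_le {R : realType} (u : R^nat) (t : R) :
  0 <= t -> (\forall n \near \oo, 0 <= u n <= t ^+ n) ->
  (limn_esup (fun n => (u n `^ n%:R^-1)%:E) <= t%:E)%E.
Proof.
move=> t0 [N _ tu]; rewrite limn_esup_lim.
apply: lime_le; first exact: is_cvg_esups.
exists N.+1 => // n /= Nn; apply: ge_ereal_sup => _ [m /= nm <-].
have m0 : (0 < m)%N by rewrite (leq_trans _ nm) // (leq_trans _ Nn).
have /andP[um tm] : 0 <= u m <= t ^+ m.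
  by apply: tu; rewrite /= (leq_trans _ nm) // ltnW.
rewrite lee_fin -[leRHS](exprn_powRV m0) //; apply: ge0_ler_powR => //.
by rewrite nnegrE exprn_ge0.
Qed.

Lemma limn_esup_le_einf_cvg {R : realType} (u : (\bar R)^nat) :
  (limn_esup u <= limn_einf u)%E -> u @ \oo --> limn_einf u.
Proof.
move=> es_ei; have ei_es : limn_einf u = limn_esup u.
  by apply/eqP; rewrite eq_le es_ei limn_einf_sup.
apply: (@squeeze_cvge _ _ _ _ (einfs u) _ (esups u)).
- apply: nearW => n; apply/andP; split.
    by apply: ereal_inf_lbound; exists n => /=.
  by apply: ereal_sup_ubound; exists n => /=.
- by rewrite limn_einf_lim; exact: is_cvg_einfs.
- by rewrite ei_es limn_esup_lim; exact: is_cvg_esups.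
Qed.

Lemma lee_of_pos_lt {R : realType} (x : R) (y : \bar R) :
  0 < x -> (forall t, 0 < t -> t < x -> (t%:E <= y)%E) -> (x%:E <= y)%E.
Proof.
move=> x0 xy; apply/lee_subgt0Pr => e e0.
(* The maximum with [x / 2] keeps the test point positive. *)
apply: (@le_trans _ _ (Num.max (x - e) (x / 2))%:E).
  by rewrite -EFinB lee_fin le_max lexx.
apply: xy; first by rewrite lt_max divr_gt0 ?orbT.
by rewrite gt_max; apply/andP; split; lra.
Qed.

Lemma lee_of_gt {R : realType} (x : R) (y : \bar R) :
  (forall t, x < t -> (y <= t%:E)%E) -> (y <= x%:E)%E.
Proof. by move=> xy; apply/lee_addgt0Pr => e e0; apply: xy; rewrite ltrDl. Qed.

(** The finitely many factors that may exceed [q] are absorbed in [C]. *)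
Lemma prod_le_geometric {R : realType} (u : R^nat) (q : R) :
  (forall n, 0 < u n) -> 0 < q -> (\forall n \near \oo, u n <= q) ->
  exists2 C, 0 < C & \forall n \near \oo, \prod_(i < n) u i <= C * q ^+ n.
Proof.
move=> u0 q0 [N _ uq]; have p0 n : 0 < \prod_(i < n) u i by rewrite prodr_gt0.
exists (\prod_(i < N) u i / q ^+ N); first by rewrite divr_gt0 ?exprn_gt0.
exists N => // n /= /subnKC <-; elim: (n - N)%N => [|k IH].
  by rewrite addn0 divfK // expf_neq0 // gt_eqF.
rewrite addnS big_ord_recr /= exprSr mulrA ler_pM ?(ltW (p0 _)) ?(ltW (u0 _)) //.
by apply: uq => /=; exact: leq_addr.
Qed.

Lemma prod_ge_geometric {R : realType} (u : R^nat) (q : R) :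
  (forall n, 0 < u n) -> 0 < q -> (\forall n \near \oo, q <= u n) ->
  exists2 c, 0 < c & \forall n \near \oo, c * q ^+ n <= \prod_(i < n) u i.
Proof.
move=> u0 q0 qu.
have [|||C C0 uC] := @prod_le_geometric _ (fun n => (u n)^-1) q^-1.
- by move=> n; rewrite invr_gt0.
- by rewrite invr_gt0.
- by apply: filterS qu => n qn; rewrite lef_pV2 ?posrE.
exists C^-1; first by rewrite invr_gt0.
apply: filterS uC => n; rewrite prodfV exprVn -[C in C / _]invrK -invfM.
by rewrite lef_pV2 // posrE ?prodr_gt0 // mulr_gt0 ?invr_gt0 ?exprn_gt0.
Qed.

(* Fekete's lemma, in multiplicative form. *)
Lemma supermultiplicative_growth {R : realType} (s : R^nat) (K : R) :
  s 0%N = 1 -> 0 < s 1%N -> (forall m n, s m * s n <= s (m + n)%N) ->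
  0 <= K -> (forall n, 0 <= s n <= K ^+ n) ->
  exists M, [/\ 0 < M, forall n, s n <= M ^+ n &
    forall y, 0 <= y -> y < M -> \forall n \near \oo, y ^+ n <= s n].
Proof.
move=> s01 s1 sM K0 sK.
have s0 n : 0 <= s n by case/andP: (sK n).
(* The growth rate [M] is the supremum of the rates attained by [s] at some positive index. *)
pose A := [set y : R | 0 <= y /\ exists2 p, (0 < p)%N & y ^+ p <= s p].
have As1 : A (s 1%N) by split; [exact: ltW|exists 1%N => //; rewrite expr1].
have ubA : has_ubound A.
  exists K => y [y0 [p p0 yp]].
  by rewrite -(@ler_pXn2r _ p) ?nnegrE // (le_trans yp) //; case/andP: (sK p).
have supA : has_sup A by split; [exists (s 1%N)|].
have M0 : 0 < sup A by apply: lt_le_trans s1 _; exact: ub_le_sup.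
exists (sup A); split => // [n|y y0 yM].
  case: n => [|n]; first by rewrite expr0 s01.
  have rn : (s n.+1 `^ n.+1%:R^-1) ^+ n.+1 = s n.+1.
    by rewrite -powR_mulrn ?powR_ge0// -powRrM mulVf ?pnatr_eq0// powRr1.
  rewrite -[leLHS]rn lerXn2r ?nnegrE ?powR_ge0 ?(ltW M0)//.
  apply: ub_le_sup => //; split; first exact: powR_ge0.
  by exists n.+1 => //; rewrite rn.
have My : 0 < sup A - y by rewrite subr_gt0.
have [z [z0 [p p0 zp]] yz] := sup_adherent My supA.
have {}yz : y < z by lra.
have {}z0 : 0 < z by lra.
(* This handles the remainder of [n] modulo [p]: [d * z <= s 1] bounds [s] below there, and [d <= 1]
   makes [d ^+ p] a loss uniform in [n], absorbed by [y < z]. *)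
pose d := Num.min (s 1%N / z) 1.
have d0 : 0 < d by rewrite /d lt_min ltr01 divr_gt0.
have d1 : d <= 1 by rewrite /d ge_min lexx orbT.
have dz : d * z <= s 1%N by rewrite -ler_pdivlMr // /d ge_min lexx.
have sr r : (d * z) ^+ r <= s r.
  elim: r => [|r IH]; last first.
    rewrite exprS (le_trans _ (sM 1%N r)) // ler_pM ?exprn_ge0 ?mulr_ge0 ?(ltW d0) ?(ltW z0)//.
  by rewrite expr0 s01.
have sq q : z ^+ (q * p) <= s (q * p)%N.
  elim: q => [|q IH]; first by rewrite expr0 s01.
  rewrite mulSn exprD (le_trans _ (sM _ _)) // ler_pM ?exprn_ge0 // ltW //.
apply: filterS (geometric_le_near (exprn_gt0 p d0) y0 yz) => n /le_trans; apply.
rewrite [n in leRHS](divn_eq n p) (le_trans _ (sM _ _)) //.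
apply: le_trans (ler_pM _ _ (sq _) (sr _)); rewrite ?exprn_ge0 ?mulr_ge0 ?(ltW d0) ?(ltW z0)//.
rewrite exprMn mulrCA -exprD -divn_eq ler_pM2r ?exprn_gt0 //.
by apply: ler_wiXn2l; rewrite ?(ltW d0) // ltnW // ltn_pmod.
Qed.

(** * Moments of the Jacobi matrix as weighted path counts *)

Section JacobiMoments.
Context {R : realType} (b : R^nat).
Hypothesis b_gt0 : forall n, 0 < b n.

(** This is the total weight of the nearest-neighbour paths of [m] steps from [0] to [k], a step
    between [j] and [j.+1] weighing [b j] in either direction. *)
Local Notation a m k := (iter m (jacobi b) (delta_seq 0) k).

Lemma jacobi_le (u v : R^nat) :
  (forall k, u k <= v k) -> forall k, jacobi b u k <= jacobi b v k.
Proof.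
move=> uv k; rewrite /jacobi lerD ?ler_pM2l //.
by case: k => // k; rewrite ler_pM2l.
Qed.

Lemma jacobiZ (c : R) (v : R^nat) k :
  jacobi b (fun j => c * v j) k = c * jacobi b v k.
Proof. by rewrite /jacobi; case: k => [|k]; ring. Qed.

(** Positivity of [b] makes [jacobi b] monotone. The case [c = 0] gives nonnegativity of [a], the
    case [c = a n 0] supermultiplicativity of the moments. *)
Lemma iter_jacobi_ge m (c : R) (v : R^nat) :
  (forall k, c * delta_seq 0 k <= v k) ->
  forall k, c * a m k <= iter m (jacobi b) v k.
Proof.
move=> cv; elim: m => [//|m IH] k; rewrite !iterS.
by rewrite -jacobiZ; exact: jacobi_le.
Qed.

Lemma iter_jacobi_ge0 m k : 0 <= a m k.
Proof.
have := @iter_jacobi_ge m 0 (delta_seq 0) _ k; rewrite mul0r; apply => j.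
by rewrite mul0r /delta_seq ler0n.
Qed.

Lemma jmomentE n : jmoment b n = a n 0%N.
Proof. exact: dotl2_delta0. Qed.

Lemma jmoment_ge0 n : 0 <= jmoment b n.
Proof. by rewrite jmomentE iter_jacobi_ge0. Qed.

(* Only the paths from 0 to 0 that are back at 0 after [n] steps are kept. *)
Lemma jmoment_supermul m n : jmoment b m * jmoment b n <= jmoment b (m + n).
Proof.
rewrite !jmomentE iterD mulrC; apply: iter_jacobi_ge => -[|k].
  by rewrite /delta_seq mulr1.
by rewrite /delta_seq mulr0 iter_jacobi_ge0.
Qed.

Lemma iter_jacobi_succ_ge m k : b k * a m k.+1 <= a m.+1 k.
Proof.
rewrite iterS /jacobi lerDl; case: k => // k.
by rewrite mulr_ge0 ?iter_jacobi_ge0 // ltW.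
Qed.

(** A path from [0] to [k] closes up by the straight descent to [0], of weight
    [\prod_(i < k) b i]. *)
Lemma prod_iter_jacobi_le k m :
  (\prod_(i < k) b i) * a m k <= jmoment b (m + k).
Proof.
elim: k m => [|k IH] m; first by rewrite big_ord0 mul1r addn0 jmomentE.
rewrite big_ord_recr /= -mulrA addnS -addSn (le_trans _ (IH m.+1)) //.
rewrite ler_pM2l ?iter_jacobi_succ_ge //.
by rewrite prodr_gt0.
Qed.

Lemma iter_jacobi_diag_gt0 k : 0 < a k k.
Proof.
elim: k => [|k IH]; first by rewrite /= /delta_seq ltr01.
rewrite iterS {1}/jacobi ltr_wpDl ?mulr_gt0 //.
by rewrite mulr_ge0 ?iter_jacobi_ge0 // ltW.
Qed.

Lemma jmoment2_gt0 : 0 < jmoment b 2.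
Proof.
by rewrite jmomentE /= /jacobi /delta_seq /= !addr0 !mulr0 add0r mulr1 mulr_gt0.
Qed.

(** Each step has at most two choices, each of weight at most [B]. *)
Lemma iter_jacobi_le (B : R) : (forall n, b n <= B) ->
  forall m k, a m k <= (2 * B) ^+ m.
Proof.
move=> bB; have B0 : 0 <= B by rewrite (le_trans _ (bB 0%N)) // ltW.
elim=> [|m IH] k.
  by rewrite /= /delta_seq expr0; case: (k == 0)%N.
rewrite iterS {1}/jacobi exprS -mulrA mulr_natl mulr2n lerD //.
  by rewrite ler_pM ?iter_jacobi_ge0 // ltW.
case: k => [|k]; first by rewrite mulr_ge0 // exprn_ge0 // mulr_ge0.
by rewrite ler_pM ?iter_jacobi_ge0 // ltW.
Qed.

(* With [u n = b n * h n.+1 / h n] the hypothesis reads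
   [u n.+1 + b n ^+ 2 / u n <= x], so that [b n ^+ 2 <= u n * (x - u n.+1)];
   in the product of these bounds the factors regroup as
   [u n * (x - u n) <= x ^+ 2 / 4]. *)
Lemma superharmonic_prod_le (h : R^nat) (x : R) : 0 < x ->
  (forall k, 0 < h k) -> (forall k, jacobi b h k <= x * h k) ->
  forall n, \prod_(i < n) b i ^+ 2 <= 4 * (x ^+ 2 / 4) ^+ n.
Proof.
move=> x0 h0 hx; pose u n := b n * h n.+1 / h n.
have u0 n : 0 < u n by rewrite /u divr_gt0 ?mulr_gt0.
have u0x : u 0%N <= x.
  by have := hx 0%N; rewrite /jacobi addr0 -ler_pdivrMr.
have bu n : b n ^+ 2 <= u n * (x - u n.+1).
  have hn0 := h0 n; have hn1 := h0 n.+1.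
  rewrite -[leRHS](_ : b n * (x * h n.+1 - b n.+1 * h n.+2) / h n = _).
    rewrite ler_pdivlMr // expr2 -mulrA ler_pM2l //.
    by rewrite lerBrDl; exact: hx n.+1.
  by rewrite /u; field; rewrite !gt_eqF.
clearbody u.
have pu n : (\prod_(i < n) b i ^+ 2) * u n <= x * (x ^+ 2 / 4) ^+ n.
  elim: n => [|n IH]; first by rewrite big_ord0 mul1r expr0 mulr1.
  rewrite big_ord_recr /= [_ ^+ n.+1]exprSr [leRHS]mulrA.
  apply: (@le_trans _ _ ((\prod_(i < n) b i ^+ 2 * u n) * ((x - u n.+1) * u n.+1))).
    rewrite -(mulrA _ (b n ^+ 2)) -(mulrA _ (u n)) ler_wpM2l //.
      by rewrite prodr_ge0 // => i _; exact: sqr_ge0.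
    by rewrite [leRHS]mulrA ler_pM2r.
  apply: ler_pM => //.
  - by rewrite mulr_ge0 ?(ltW (u0 _)) // prodr_ge0 // => i _; exact: sqr_ge0.
  - rewrite mulr_ge0 ?(ltW (u0 _)) // -(pmulr_rge0 _ (u0 n)).
    exact: le_trans (sqr_ge0 _) (bu n).
  - by have := sqr_ge0 (x - 2 * u n.+1); lra.
(* Dividing [pu] by [u n] would need a lower bound on [u n]. The last factor is bounded by [u n * x]
   instead, and [x ^+ 2 = 4 * (x ^+ 2 / 4)] produces the constant. *)
case=> [|n]; first by rewrite big_ord0 expr0; lra.
rewrite big_ord_recr /=.
apply: (@le_trans _ _ ((\prod_(i < n) b i ^+ 2 * u n) * x)).
  rewrite -mulrA ler_wpM2l ?prodr_ge0 // => [i _|]; first exact: sqr_ge0.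
  by apply: le_trans (bu n) _; rewrite ler_pM2l // gerBl ltW.
rewrite exprSr (_ : 4 * _ = x * (x ^+ 2 / 4) ^+ n * x); last by field.
by rewrite ler_pM2r.
Qed.

Lemma prod_le_of_moment_growth (r x : R) : 0 <= r -> r < x ->
  (forall n, jmoment b n <= r ^+ n) ->
  forall n, \prod_(i < n) b i ^+ 2 <= 4 * (x ^+ 2 / 4) ^+ n.
Proof.
move=> r0 rx jr; have x0 : 0 < x by exact: le_lt_trans rx.
pose f k m := a m k / x ^+ m.
have f0 k m : 0 <= f k m.
  by rewrite divr_ge0 ?iter_jacobi_ge0 // exprn_ge0 // ltW.
(* Closing paths bounds [a m k] by [r ^+ (m + k)] up to a factor depending on [k] only, hence a
   geometric majorant of ratio [r / x < 1]. *)
have cf k : cvgn (series (f k)).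
  have c0 : 0 < \prod_(i < k) b i by rewrite prodr_gt0.
  apply: (@series_le_cvg _ _ (geometric (r ^+ k / \prod_(i < k) b i) (r / x))) => //.
  - by move=> m; rewrite /geometric /= mulr_ge0 ?exprn_ge0 ?divr_ge0 ?exprn_ge0 // ltW.
  - move=> m; rewrite /geometric /= /f expr_div_n mulrA ler_pM2r ?invr_gt0 ?exprn_gt0 //.
    rewrite mulrAC ler_pdivlMr // mulrC -exprD addnC.
    exact: le_trans (prod_iter_jacobi_le _ _) (jr _).
  apply: is_cvg_geometric_series.
  by rewrite ger0_norm ?divr_ge0 ?(ltW x0) // ltr_pdivrMr // mul1r.
pose h k := limn (series (f k)).
have fh k N : series (f k) N <= h k.
  apply: nondecreasing_cvgn_le => //.
  apply/nondecreasing_seqP => n; rewrite /series /= big_nat_recr //= lerDl //.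
apply: (@superharmonic_prod_le h) => // k.
  (* The term of index [k], from the straight ascent to [k], is already positive. *)
  apply: lt_le_trans (fh k k.+1); rewrite /series /= big_nat_recr //=.
  rewrite ltr_wpDl ?sumr_ge0 // divr_gt0 ?iter_jacobi_diag_gt0 //.
  exact: exprn_gt0.
(* Applying [jacobi b] to [N] terms gives [x] times the terms of index [1] to [N]; dropping the term
   of index [0] leaves an inequality, and [N] tends to infinity afterwards. *)
have step N : jacobi b (fun j => series (f j) N) k <= x * h k.
  apply: (@le_trans _ _ (x * series (f k) N.+1)); last by rewrite ler_pM2l.
  rewrite /series /= big_nat_recl //= mulrDr ler_wpDl //.
    by rewrite mulr_ge0 // ltW.
  rewrite mulr_sumr /jacobi mulr_sumr.
  rewrite (_ : (if k is j.+1 then _ else 0) =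
    \sum_(0 <= i < N) (if k is j.+1 then b j * f j i else 0)); last first.
    by case: k => [|k]; [rewrite big1|rewrite mulr_sumr].
  rewrite -big_split /= ler_sum // => i _; rewrite le_eqVlt; apply/predU1l.
  have xi : x ^+ i != 0 by rewrite expf_neq0 // gt_eqF.
  have xn0 : x != 0 by rewrite gt_eqF.
  rewrite /f iterS {3}/jacobi exprS; case: k => [|k]; field; by rewrite ?xi.
apply: (@cvgr_to_le _ \oo _ _ (fun N => jacobi b (fun j => series (f j) N) k)).
  rewrite /jacobi; apply: cvgD; first by apply: cvgMr; exact: cf.
  case: k {step} => [|k]; first exact: cvg_cst.
  by apply: cvgMr; exact: cf.
exact: nearW.
Qed.

End JacobiMoments.

(** * Comparison of the growth rates of moments and products *)

Theorem propositionA1 (R : realType) (b : R^nat)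
    (b_gt0 : forall n, 0 < b n) (b_bounded : bounded_fun b) :
  let V : (\bar R)^nat := fun n => (U b n `^ n%:R^-1)%:E in
  (4%:E <= limn_einf V)%E /\
  (forall l : R, 0 <= l -> b @ \oo --> l -> V @ \oo --> limn_einf V).
Proof.
move=> V.
pose s n := jmoment b n.*2; pose P n := \prod_(i < n) b i ^+ 2.
have P0 n : 0 < P n by rewrite prodr_gt0 // => i _; exact: exprn_gt0.
have s0 n : 0 <= s n by exact: jmoment_ge0.
have [B bB] : exists B, forall n, b n <= B.
  have [B [_ bB]] := b_bounded; exists (B + 1) => n.
  by rewrite (le_trans (ler_norm _)) // bB // ltrDl.
have B0 : 0 <= B by rewrite (le_trans _ (bB 0%N)) // ltW.
have [|||||M [M0 sM Ms]] := @supermultiplicative_growth _ s ((2 * B) ^+ 2).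
- by rewrite /s jmomentE.
- exact: jmoment2_gt0.
- by move=> m n; rewrite /s doubleD; exact: jmoment_supermul.
- exact: sqr_ge0.
- move=> n; rewrite s0 /s jmomentE -exprM mul2n.
  exact: iter_jacobi_le.
(* Any [t < M / q] bounds the liminf below; the midpoint [y] of [t * q] and [M] leaves room to
   absorb [C]. *)
have V_ge C q t : 0 < C -> 0 < q -> (\forall n \near \oo, P n <= C * q ^+ n) ->
    0 < t -> t * q < M -> (t%:E <= limn_einf V)%E.
  move=> C0 q0 Pq t0 tqM; apply: limn_einf_root_ge; first exact: ltW.
  pose y := (t * q + M) / 2.
  have tq0 : 0 < t * q by rewrite mulr_gt0.
  have y0 : 0 < y by rewrite /y; lra.
  have ty : t < y / q by rewrite ltr_pdivlMr // /y; lra.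
  have yM : y < M by rewrite /y; lra.
  have C10 : 0 < C^-1 by rewrite invr_gt0.
  apply: filterS3 (geometric_le_near C10 (ltW t0) ty) (Ms _ (ltW y0) yM) Pq.
  move=> n tn yn Pn; apply: le_trans tn _.
  rewrite -[U b n]/(s n / P n) ler_pdivlMr //; apply: le_trans yn.
  have Cq0 : 0 < C * q ^+ n by rewrite mulr_gt0 ?exprn_gt0.
  rewrite expr_div_n (_ : _ * _ = y ^+ n * (P n / (C * q ^+ n))).
    by rewrite ler_piMr ?exprn_ge0 ?(ltW y0) // ler_pdivrMr // mul1r.
  by rewrite /P invfM; ring.
have V_le c q t : 0 < c -> 0 < q -> (\forall n \near \oo, c * q ^+ n <= P n) ->
    M < t * q -> (limn_esup V <= t%:E)%E.
  move=> c0 q0 qP Mtq.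
  have Mqt : M / q < t by rewrite ltr_pdivrMr.
  have Mq0 : 0 <= M / q by rewrite divr_ge0 // ltW.
  apply: limn_esup_root_le; first exact: le_trans (ltW Mqt).
  apply: filterS2 (geometric_le_near c0 Mq0 Mqt) qP => n tn Pn.
  rewrite -[U b n]/(s n / P n) divr_ge0 ?s0 ?(ltW (P0 _)) //= ler_pdivrMr //.
  apply: le_trans (sM n) _.
  rewrite -[M](@divfK _ q) ?gt_eqF // exprMn.
  apply: (@le_trans _ _ (t ^+ n * (c * q ^+ n))).
    by rewrite mulrCA mulrA ler_pM2r ?exprn_gt0.
  by rewrite ler_pM2l // exprn_gt0 // (le_lt_trans Mq0).
split.
  apply: lee_of_pos_lt => // t t0 t4.
  (* Odd moments are controlled too, since the square of the [n]-th moment is at most [s n]. *)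
  have jM n : jmoment b n <= Num.sqrt M ^+ n.
    rewrite -(@ler_pXn2r _ 2) ?nnegrE ?exprn_ge0 ?sqrtr_ge0 ?jmoment_ge0 //.
    rewrite -exprM mulnC exprM sqr_sqrtr ?(ltW M0) // expr2.
    by apply: le_trans (sM n); rewrite /s -addnn; exact: jmoment_supermul.
  (* [z] plays the role of [x ^+ 2]: above [M] for the resolvent to converge, below [4 * M / t] so
     that [t * (z / 4) < M]. *)
  pose z := (M + 4 * M / t) / 2.
  have tMt : t * (M / t) = M by rewrite mulrCA divff ?mulr1 // gt_eqF.
  have Mt : M < 4 * M / t by rewrite ltr_pdivlMr // mulrC ltr_pM2r.
  have z0 : 0 < z by rewrite /z; lra.
  have Mz : M < z by rewrite /z; lra.
  apply: (V_ge 4 (z / 4)) => //; first by rewrite divr_gt0.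
    apply: nearW => n; rewrite -[z in z / 4]sqr_sqrtr ?(ltW z0) //.
    apply: (prod_le_of_moment_growth _ (sqrtr_ge0 M)) => //.
    by rewrite ltr_sqrt.
  by rewrite /z; nra.
move=> l l0 bl; apply: limn_esup_le_einf_cvg.
have bl2 : (fun n => b n ^+ 2) @ \oo --> l ^+ 2 by exact: cvgM.
have b20 n : 0 < b n ^+ 2 by exact: exprn_gt0.
have einf_ge t : 0 < t -> t * l ^+ 2 < M -> (t%:E <= limn_einf V)%E.
  (* Being strictly between [l ^+ 2] and [M / t], [q] eventually dominates [b n ^+ 2] and still
     satisfies [t * q < M]. *)
  move=> t0 tlM; pose q := (l ^+ 2 + M / t) / 2.
  have lM : l ^+ 2 < M / t by rewrite ltr_pdivlMr // mulrC.
  have lq : l ^+ 2 < q by rewrite /q; lra.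
  have q0 : 0 < q by exact: le_lt_trans (sqr_ge0 l) lq.
  have [C C0 PC] := prod_le_geometric b20 q0 (cvgr_le _ bl2 _ lq).
  by apply: (V_ge C q) => //; rewrite mulrC -ltr_pdivlMr // /q; lra.
have [l_eq0|l_neq0] := eqVneq l 0.
  (* For [l = 0] the condition [t * l ^+ 2 < M] holds for every [t]. *)
  suff -> : limn_einf V = +oo%E by rewrite leey.
  apply/eqyP => t t0; apply: einf_ge => //.
  by rewrite l_eq0 expr0n mulr0.
have l20 : 0 < l ^+ 2 by rewrite exprn_gt0 // lt_neqAle eq_sym l_neq0.
apply: (@le_trans _ _ (M / l ^+ 2)%:E); last first.
  apply: lee_of_pos_lt; first exact: divr_gt0.
  by move=> t t0; rewrite ltr_pdivlMr //; exact: einf_ge.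
apply: lee_of_gt => t; rewrite ltr_pdivrMr // => Mtl.
have t0 : 0 < t by rewrite -(pmulr_lgt0 _ l20); exact: lt_trans Mtl.
pose q := (l ^+ 2 + M / t) / 2.
have Ml : M / t < l ^+ 2 by rewrite ltr_pdivrMr // mulrC.
have ql : q < l ^+ 2 by rewrite /q; lra.
have Mt0 : 0 < M / t by rewrite divr_gt0.
have q0 : 0 < q by rewrite /q; lra.
have [c c0 cP] := prod_ge_geometric b20 q0 (cvgr_ge _ bl2 _ ql).
by apply: (V_le c q) => //; rewrite mulrC -ltr_pdivrMr // /q; lra.
Qed.
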